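(* Let $d \ge 2$ and let $g : \mathbb{R}^d \to \mathbb{R}^d$ be continuous and linearly homogeneous with $g(\mathbf{x}) = \mathbf{0}$ only for $\mathbf{x} = \mathbf{0}$. Let $G : \mathbb{S}^{d-1} \to \mathbb{S}^{d-1}$ be given by $G(\mathbf{z}) = g(\mathbf{z})/\|g(\mathbf{z})\|$. Let $\mu_1, \ldots, \mu_m$ be a finite collection of (pairwise distinct) physical measures of $G$, and let $\eta_1, \ldots, \eta_m$ denote the spherical measures of their basins. Suppose $\sum_{j=1}^m \eta_j = 1$ (i.e. the union of the basins has full measure on $\mathbb{S}^{d-1}$) and $\lambda(\mu_j) \ne 0$ for each $j \in \{1, \ldots, m\}$. Then $\mathbf{0}$ is a measure-$\rho$ stable fixed point of $g$, where $$\rho = \sum_{j \,:\, \lambda(\mu_j) < 0} \eta_j .$$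
   Context: $\mathbf{0}$ is the origin of $\mathbb{R}^d$, $\|\cdot\|$ is the Euclidean norm, $B_r = \{\mathbf{x} \in \mathbb{R}^d : \|\mathbf{x}\| < r\}$, $\mathbb{S}^{d-1} = \{\mathbf{x} \in \mathbb{R}^d : \|\mathbf{x}\| = 1\}$, $\mathrm{meas}$ is Lebesgue measure on $\mathbb{R}^d$, and superscripts on maps denote iterates. A map $g : \mathbb{R}^d \to \mathbb{R}^d$ is linearly homogeneous if $g(\alpha \mathbf{x}) = \alpha g(\mathbf{x})$ for all $\mathbf{x} \in \mathbb{R}^d$ and all real $\alpha \ge 0$. (In particular $g(\mathbf{0}) = \mathbf{0}$.) Define $D : \mathbb{S}^{d-1} \to (0,\infty)$ by $D(\mathbf{z}) = \|g(\mathbf{z})\|$; both $D$ and $G$ are well-defined and continuous. For any invariant (Borel) probability measure $\mu$ of $G$, define $\lambda(\mu) = \int_{\mathbb{S}^{d-1}} \ln(D)\, d\mu$. The spherical measure of $\Omega \subset \mathbb{S}^{d-1}$ is $\mathrm{meas}(\{\alpha \mathbf{z} : \mathbf{z} \in \Omega,\ 0 \le \alpha \le 1\})/\mathrm{meas}(B_1)$. The basin of an invariant probability measure $\mu$ of $G$ is the set of all $\mathbf{z} \in \mathbb{S}^{d-1}$ for which $\lim_{n \to \infty} \frac{1}{n}\sum_{i=0}^{n-1} \varphi(G^i(\mathbf{z})) = \int_{\mathbb{S}^{d-1}} \varphi\, d\mu$ for all continuous $\varphi : \mathbb{S}^{d-1} \to \mathbb{R}$. A physical measure of $G$ is an invariant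 probability measure of $G$ whose basin has positive spherical measure. Let $F : \mathbb{R}^d \to \mathbb{R}^d$ be continuous with $F(\mathbf{0}) = \mathbf{0}$. For $\varepsilon, \delta > 0$ let $A(\varepsilon,\delta)$ be the set of all $\mathbf{x} \in B_\delta$ for which $F^n(\mathbf{x}) \to \mathbf{0}$ as $n \to \infty$ with $F^n(\mathbf{x}) \in B_\varepsilon$ for all $n \ge 0$. The fixed point $\mathbf{0}$ of $F$ is measure-$\rho$ stable if the limit $\lim_{\varepsilon \to 0} \lim_{\delta \to 0} \frac{\mathrm{meas}(A(\varepsilon,\delta))}{\mathrm{meas}(B_\delta)}$ exists and equals $\rho$. *)

(* Defs.v *)
From HB Require Import structures.
From mathcomp Require Export all_boot all_order all_algebra.
From mathcomp Require Export all_classical all_reals all_analysis.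
Import Order.TTheory GRing.Theory Num.Theory.
Import numFieldNormedType.Exports.
Set Implicit Arguments.
Unset Strict Implicit.
Unset Printing Implicit Defensive.
Local Open Scope classical_set_scope.
Local Open Scope ring_scope.

Section EuclideanSpace.
Context {R : realType} {d : nat}.
Implicit Types (x : 'rV[R]_d) (A : set 'rV[R]_d).

(* The library norm on ['rV[R]_d] is the max norm; its topology is the
   Euclidean one. *)
Definition enorm x : R := Num.sqrt (\sum_(i < d) x 0 i ^+ 2).

Definition eball (r : R) : set 'rV[R]_d := [set x | enorm x < r].

Definition box (a b : 'rV[R]_d) : set 'rV[R]_d :=
  [set x | forall i, a 0 i <= x 0 i <= b 0 i].

Definition box_volume (a b : 'rV[R]_d) : R := \prod_(i < d) (b 0 i - a 0 i).

(* Lebesgue outer measure, i.e. the infimum of the total volume of countable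
   covers by closed boxes; it is Lebesgue measure on the Lebesgue measurable
   sets, in particular on Borel sets. *)
Definition meas A : \bar R :=
  ereal_inf [set v | exists a b : nat -> 'rV[R]_d,
    [/\ (forall k i, a k 0 i <= b k 0 i),
        A `<=` \bigcup_k box (a k) (b k) &
        v = (\sum_(0 <= k <oo) (box_volume (a k) (b k))%:E)%E]].

Definition linearly_homogeneous (g : 'rV[R]_d -> 'rV[R]_d) :=
  forall (a : R) x, 0 <= a -> g (a *: x) = a *: g x.

Definition stable_set (F : 'rV[R]_d -> 'rV[R]_d) (e r : R) : set 'rV[R]_d :=
  [set x | [/\ eball r x,
    (fun n => iter n F x) @ \oo --> (0 : 'rV[R]_d) &
    forall n, eball e (iter n F x)]].

(* [L e] is the inner limit, which is required to exist for every [e > 0]. *)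
Definition measure_stable_fixed_point (F : 'rV[R]_d -> 'rV[R]_d) (rho : R) :=
  F 0 = 0 /\
  exists L : R -> R,
    (forall e, 0 < e ->
      fine (meas (stable_set F e r)) / fine (meas (eball r)) @[r --> 0^'+]
        --> L e) /\
    L e @[e --> 0^'+] --> rho.

End EuclideanSpace.


Section Sphere.
Context (R : realType) (n : nat).

Definition unit_sphere : set 'rV[R]_n.+1 := [set x | enorm x = 1].

(* The sphere of dimension [n] in the Euclidean space of dimension [n.+1], with
   the subspace topology.  The ambient dimension is a successor because
   measurable types are pointed. *)
Definition sphere : Type := set_type unit_sphere.

HB.instance Definition _ := Topological.copy sphere (set_type unit_sphere).

Lemma enorm_delta : enorm (delta_mx 0 0 : 'rV[R]_n.+1) = 1.
Proof.
rewrite /enorm (bigD1 ord0)//= mxE eqxx expr1n big1 ?addr0 ?sqrtr1// => i i0.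
by rewrite mxE (negbTE i0) andbF expr0n.
Qed.

HB.instance Definition _ :=
  isPointed.Build sphere (SigSub (mem_set enorm_delta) : set_type unit_sphere).

Definition borel_sphere := g_sigma_algebraType (@open sphere).

End Sphere.

Section SphereDynamics.
Context {R : realType} {n : nat}.
Notation S := (sphere R n).
Notation Sb := (borel_sphere R n).
Implicit Types (G : S -> S) (mu : probability Sb R).

Definition spherical_measure (Om : set S) : R :=
  fine (meas [set x : 'rV[R]_n.+1 | exists a (z : S),
          [/\ Om z, 0 <= a <= 1 & x = a *: val z]])
  / fine (meas (eball 1 : set 'rV[R]_n.+1)).

Definition invariant G mu :=
  forall A : set Sb, measurable A -> mu (G @^-1` A) = mu A.

Definition basin G mu : set S :=
  [set z | forall phi : S -> R, continuous phi ->
    (k%:R^-1 * \sum_(0 <= i < k) phi (iter i G z)) @[k --> \oo]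
      --> (\int[mu]_z phi z)%R].

Definition physical_measure G mu :=
  invariant G mu /\ 0 < spherical_measure (basin G mu).

Definition lambda (g : 'rV[R]_n.+1 -> 'rV[R]_n.+1) mu : R :=
  (\int[mu]_z ln (enorm (g (val (z : S)))))%R.

(* A term of type [probability] also has values on non-measurable sets, so two
   different terms may be the same measure. *)
Definition distinct_measures (mu nu : probability Sb R) :=
  exists2 A : set Sb, measurable A & mu A != nu A.

End SphereDynamics.

(* Main.v *)
From HB Require Import structures.
Require Import Defs.
From mathcomp Require Import ring lra measurable_realfun.
Import Order.TTheory GRing.Theory Num.Theory.
Import numFieldNormedType.Exports.
Set Implicit Arguments.
Unset Strict Implicit.
Unset Printing Implicit Defensive.
Local Open Scope classical_set_scope.
Local Open Scope ring_scope.

(** Along the ray through a unit vector z, the orbit of [g] is explicit: by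
    homogeneity, ||g^k(a z)|| = a exp(sum_(i < k) ln D(G^i z)), with
    D(z) = ||g(z)|| ([enorm_iter]).  The function ln D is continuous on the
    sphere because [g] vanishes only at the origin, so on the basin of mu_j the
    Birkhoff averages of ln D converge to lambda(mu_j).  Hence the whole open
    ray converges to 0 when lambda(mu_j) < 0 ([iter_cvg0]), and no point of it
    does when lambda(mu_j) > 0 ([iter_ncvg0]).

    Let C be the set of the points of the unit ball that [g] attracts to 0.  By
    homogeneity the stable set for (e, r) is r times the stable set for
    (e / r, 1), and the latter increases to C as r tends to 0, because
    convergent orbits are bounded.  Continuity from below thus gives
    meas C / meas B_1 as the inner limit for every e ([stable_density_cvg]), and
    it remains to compute meas C from the basins.

    Since [meas] is an outer measure, disjoint sets whose measures add up to
    that of the ball need not fill it unless they are measurable.  Proving that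
    the basins are measurable would take a countable dense family of continuous
    functions; this is avoided by enlarging them.  Only finitely many test
    functions matter: ln D, and for each pair i <> j one continuous function
    with different integrals for mu_i and mu_j, which exists because a Borel
    probability measure on the sphere is determined by the integrals of
    continuous functions ([distinct_measures_separated]).  The cone W_j of the
    nonzero x for which the averages of these functions along the orbit of the
    direction of x converge to their mu_j-integrals is measurable, is disjoint
    from the other cones, and contains the basin of mu_j.  The traces of the W_j
    on the unit ball have total measure at most meas B_1, while the spherical
    measures of the basins already add up to 1, so equality holds for each j:
    the trace of W_j has normalized measure eta_j, and together the traces fill
    the ball up to a null set.  Those with lambda(mu_j) < 0 lie in C, the others
    are disjoint from C, and meas C / meas B_1 = rho follows. *)

(** * Box-cover outer measure *)

Section LebesgueOuterMeasure.
Context {R : realType} {n : nat}.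
Local Notation V := 'rV[R]_n.+1.
Implicit Types (A : set V) (a b : V).
Local Open Scope ereal_scope.

Lemma box_volume_ge0 a b : (forall i, (a 0 i <= b 0 i)%R) ->
  0 <= (box_volume a b)%:E.
Proof. by move=> ab; rewrite lee_fin prodr_ge0// => i _; rewrite subr_ge0. Qed.

Lemma box_volume_degenerate a : box_volume a a = 0%R.
Proof. by rewrite /box_volume (bigD1 ord0)//= subrr mul0r. Qed.

Lemma meas_ge0 A : 0 <= meas A.
Proof.
apply: le_ereal_inf_tmp => _ [a [b [ab _ ->]]].
by apply: nneseries_ge0 => k _ _; exact: box_volume_ge0.
Qed.

Lemma meas_le_cover A (a b : nat -> V) :
    (forall k i, (a k 0 i <= b k 0 i)%R) -> A `<=` \bigcup_k box (a k) (b k) ->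
  meas A <= \sum_(0 <= k <oo) (box_volume (a k) (b k))%:E.
Proof. by move=> ab Aab; apply: ereal_inf_lbound; exists a, b. Qed.

Lemma meas_box_le a b : (forall i, (a 0 i <= b 0 i)%R) ->
  meas (box a b) <= (box_volume a b)%:E.
Proof.
move=> ab; pose b' k := if k is 0%N then b else a.
apply: (le_trans (@meas_le_cover _ (fun=> a) b' _ _)).
- by case.
- by move=> x xab; exists 0%N.
- rewrite nneseries_recl//; last first.
    by move=> k _; apply: box_volume_ge0; case: k.
  by rewrite eseries0 ?adde0// => -[//|k] _ _; rewrite /= box_volume_degenerate.
Qed.

Lemma meas_mono : {homo @meas R n.+1 : A B / A `<=` B >-> A <= B}.
Proof.
move=> A B AB; apply: ereal_inf_le_tmp => _ [a [b [ab Bab ->]]].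
by exists a, b; split => //; exact: subset_trans Bab.
Qed.

Lemma meas_set1 a : meas [set a] = 0.
Proof.
have := @meas_box_le a a (fun=> lexx _); rewrite box_volume_degenerate => a0.
apply/eqP; rewrite eq_le meas_ge0 andbT; apply: le_trans a0.
by apply: meas_mono => _ -> i; rewrite lexx.
Qed.

Lemma meas_set0 : @meas R n.+1 set0 = 0.
Proof.
by apply/eqP; rewrite eq_le meas_ge0 andbT -[leRHS](meas_set1 0) meas_mono.
Qed.

(** Cover the k-th set by boxes with an excess of e / 2^(k+1), and enumerate the
    doubly indexed family of boxes along a bijection of nat with nat * nat. *)
Lemma meas_sigma_subadditive : sigma_subadditive (@meas R n.+1).
Proof.
move=> A; have [[i ioo]|] := pselect (exists i, meas (A i) = +oo).
  rewrite (eseries_pinfty _ _ ioo) ?leey// => k _.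
  by rewrite gt_eqF// (lt_le_trans _ (meas_ge0 _)).
rewrite -forallNE => Aoo.
apply/lee_addgt0Pr => e e0.
rewrite (le_trans _ (epsilon_trick _ _ (ltW e0)))//; last first.
  by move=> k; exact: meas_ge0.
pose P k (ab : nat -> V * V) := [/\
  forall j i, ((ab j).1 0%R i <= (ab j).2 0%R i)%R,
  A k `<=` \bigcup_j box (ab j).1 (ab j).2 &
  \sum_(0 <= j <oo) (box_volume (ab j).1 (ab j).2)%:E
    <= meas (A k) + (e / (2 ^ k.+1)%:R)%:E].
have [C PC] : {C : nat -> nat -> V * V & forall k, P k (C k)}.
  apply: (@choice _ _ P) => k.
  have Afin : meas (A k) \is a fin_num.
    by rewrite ge0_fin_numE ?meas_ge0// ltey; exact/eqP.
  have ek : (0 < e / (2 ^ k.+1)%:R)%R by rewrite divr_gt0.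
  have [_ [a [b [ab Aab ->]]] lt] := lb_ereal_inf_adherent ek Afin.
  by exists (fun j => (a j, b j)); split => //; exact: ltW.
pose vol (p : nat * nat) := (box_volume (C p.1 p.2).1 (C p.1 p.2).2)%:E.
have vol0 p : 0 <= vol p by apply: box_volume_ge0 => i; case: (PC p.1).
apply: (@le_trans _ _ (\esum_(p in setT) vol p)).
  have /card_esym/ppcard_eqP[f] := card_nat2.
  apply: (le_trans (@meas_le_cover _ (fun k => (C (f k).1 (f k).2).1)
    (fun k => (C (f k).1 (f k).2).2) _ _)).
  - by move=> k i; case: (PC (f k).1).
  - move=> t [i _]; have [_ Ai _] := PC i; move=> /Ai[j _ tij].
    by exists (f^-1%FUN (i, j)) => //=; rewrite invK ?inE.
  - rewrite -(esum_pred_image vol _ xpredT) ?[fun=> _]set_true//.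
    by rewrite image_eq.
pose J : nat -> set (nat * nat) := fun i => [set (i, j) | j in setT].
rewrite (_ : setT = \bigcup_k J k); last first.
  by rewrite predeqE => -[a b]; split => // _; exists a => //; exists b.
rewrite esum_bigcupT//=; last first.
  apply/trivIsetP => i j _ _ ij.
  rewrite predeqE => -[k l] /=; split => //= -[] [_] _ [<-{k} _].
  by move=> [l' _] [] /esym/eqP; rewrite (negbTE ij).
rewrite -(image_id [set: nat]) -fun_true esum_pred_image//; last first.
  by move=> k _; exact: esum_ge0.
apply: lee_nneseries => [k _ _|k _]; first exact: esum_ge0.
have [_ _] := PC k; apply: le_trans.
rewrite le_eqVlt; apply/orP; left; apply/eqP.
rewrite -[RHS](@esum_pred_image _ _ vol (pair k) predT)//=; last first.
  by move=> ? ? _ _; exact: (@can_inj _ _ _ snd).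
by congr esum; rewrite predeqE => -[a b]; split; move=> [i _ <-]; exists i.
Qed.
End LebesgueOuterMeasure.

(** * Measurable sets and scaling *)

HB.instance Definition _ (R : realType) (n : nat) :=
  isOuterMeasure.Build R 'rV[R]_n.+1 (@meas R n.+1)
    meas_set0 meas_ge0 meas_mono meas_sigma_subadditive.

Definition outer_meas (R : realType) (n : nat)
  : {outer_measure set 'rV[R]_n.+1 -> \bar R} := @meas R n.+1.

Definition lebesgue (R : realType) (n : nat)
    : {measure set (caratheodory_type (@meas R n.+1)) -> \bar R} :=
  (@outer_meas R n : set (caratheodory_type (@outer_meas R n)) -> \bar R).

Section LebesgueMeasurable.
Context {R : realType} {n : nat}.
Local Notation V := 'rV[R]_n.+1.
Local Notation L := (caratheodory_type (@meas R n.+1)).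
Implicit Types (A : set V) (a b x : V).

Definition with_coord i (t : R) x : V := \row_j (if j == i then t else x 0 j).

Lemma box_volume_with_coord i t a b :
  box_volume a (with_coord i t b) + box_volume (with_coord i t a) b
    = box_volume a b.
Proof.
rewrite /box_volume.
have E (u v : V) : (\prod_(j < n.+1) (v 0 j - u 0 j) =
    (v 0 i - u 0 i) * \prod_(j < n.+1 | j != i) (v 0 j - u 0 j))%R.
  by rewrite (bigD1 i).
rewrite !E !mxE eqxx.
rewrite (eq_bigr (fun j => b 0 j - a 0 j)); last first.
  by move=> j /negbTE ji; rewrite mxE ji.
rewrite [X in _ + _ * X](eq_bigr (fun j => b 0 j - a 0 j)); last first.
  by move=> j /negbTE ji; rewrite mxE ji.
ring.
Qed.

(** A hyperplane orthogonal to a coordinate axis cuts a box into two boxes whose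
    volumes add up, so it cuts every cover into a cover of each side at no
    cost. *)
Lemma halfspace_measurable i (c : R) :
  (@meas R n.+1).-caratheodory [set x : V | x 0 i <= c].
Proof.
apply: le_caratheodory_measurable => X.
apply: le_ereal_inf_tmp => _ [a [b [ab Xab ->]]].
(* The cutting height [c], clamped to the side of the [k]-th box. *)
pose t k := Num.max (a k 0 i) (Num.min (b k 0 i) c).
have tab k : a k 0 i <= t k <= b k 0 i.
  by rewrite /t le_max lexx /= ge_max ab ge_min lexx.
pose b' k := with_coord i (t k) (b k); pose a' k := with_coord i (t k) (a k).
have ab' k j : a k 0 j <= b' k 0 j.
  by rewrite mxE; case: eqP => [->|]; [case/andP: (tab k)|].
have a'b k j : a' k 0 j <= b k 0 j.
  by rewrite mxE; case: eqP => [->|]; [case/andP: (tab k)|].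
rewrite (eq_eseriesr (g := fun k => (box_volume (a k) (b' k))%:E
    + (box_volume (a' k) (b k))%:E)%E); last first.
  by move=> k _; rewrite -EFinD box_volume_with_coord.
rewrite nneseriesD; last 2 first.
- by move=> k _ _; exact: box_volume_ge0.
- by move=> k _ _; exact: box_volume_ge0.
apply: leeD; apply: meas_le_cover => // x [Xx xc].
- have [k _ xk] := Xab _ Xx; exists k => // j; rewrite mxE.
  have /andP[-> xb]/= := xk j; case: eqP => // ji; subst j.
  by rewrite /t le_max le_min xb xc orbT.
- have [k _ xk] := Xab _ Xx; exists k => // j; rewrite mxE.
  have /andP[ax ->]/= := xk j; case: eqP => [ji|_]; rewrite andbT//; subst j.
  move/negP: xc; rewrite -ltNge => /ltW cx.
  by rewrite /t ge_max ax ge_min cx orbT.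
Qed.

Lemma rV_norm_ltP x (r : R) : 0 < r ->
  `|x| < r <-> forall i, `|x 0 i| < r.
Proof.
move=> r0; rewrite {1}/Num.norm/= mx_normrE; split.
  by move=> /bigmax_ltP[_ h] i; exact: (h (ord0, i) isT).
by move=> h; apply/bigmax_ltP; split => // -[j i] _ /=; rewrite (ord1 j).
Qed.

Lemma norm_ball_measurable x (r : R) :
  measurable ([set y | `|y - x| < r] : set L).
Proof.
have [r0|r0] := ltP 0 r; last first.
  rewrite (_ : [set _ | _] = set0)// -subset0 => y /= /lt_le_trans /(_ r0).
  by rewrite normr_lt0.
have -> : [set y | `|y - x| < r] = \bigcap_(i in [set: 'I_n.+1])
    ((~` [set y : V | y 0 i <= x 0 i - r]) `&`
    \bigcup_k [set y : V | y 0 i <= x 0 i + r - k.+1%:R^-1]).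
  apply/seteqP; split=> y /=.
    move=> /(rV_norm_ltP _ r0) h i _; have := h i.
    rewrite !mxE/= ltr_norml => /andP[lo hi]; split.
      by apply/negP; rewrite -ltNge; lra.
    have yx : y ord0 i < x ord0 i + r by lra.
    have [k ke] := ltr_add_invr yx.
    by exists k => //=; move: ke; set u := _^-1 => ke; lra.
  move=> h; apply/rV_norm_ltP => // i.
  rewrite !mxE; have [/negP lo [k _ /= hi]] := h i I.
  rewrite ltr_norml; rewrite -ltNge in lo.
  have k0 : 0 < k.+1%:R^-1 :> R by rewrite invr_gt0.
  move: k0 hi; set u := _^-1 => k0 hi.
  by apply/andP; split; lra.
apply: fin_bigcap_measurable => // i _; apply: measurableI.
  exact/measurableC/halfspace_measurable.
by apply: bigcupT_measurable => k; exact: halfspace_measurable.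
Qed.

Lemma rat_rV_dense x (r : R) : 0 < r ->
  exists q : 'rV[rat]_n.+1, `|x - map_mx ratr q| < r.
Proof.
move=> r0.
have H i : exists q : rat, `|x 0 i - ratr q| < r.
  have xr : x 0 i < x 0 i + r by rewrite ltrDl.
  have [q] := rat_in_itvoo xr; rewrite in_itv/= => /andP[xq qx].
  by exists q; rewrite ltr_norml; apply/andP; split; lra.
have [q qP] := choice H.
by exists (\row_i q i); apply/rV_norm_ltP => // i; rewrite !mxE.
Qed.

(** Countability of the index type makes this usable in any sigma-algebra that
    contains the balls, both on the space and on the sphere. *)
Lemma open_bigcup_rational_balls A : open A ->
  A = \bigcup_(p in [set p : 'rV[rat]_n.+1 * nat |
                    [set y | `|y - map_mx ratr p.1| < p.2.+1%:R^-1] `<=` A])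
        [set y | `|y - map_mx ratr p.1| < p.2.+1%:R^-1].
Proof.
move=> oA; apply/seteqP; split => [x Ax|x [p pA]]; last exact: pA.
have /nbhs_ballP[e /= e0 eA] : nbhs x A by apply: open_nbhs_nbhs.
have [k ke] := ltr_add_invr e0; rewrite add0r in ke.
have k0 : 0 < k.+1%:R^-1 :> R by rewrite invr_gt0.
have e2 : 0 < (k.*2).+2%:R^-1 :> R by rewrite invr_gt0.
(* A radius of half of [k.+1%:R^-1] makes the ball around [q] contain [x]
   and stay within [e] of it. *)
have [q xq] := rat_rV_dense x e2.
have k2 : (k.*2).+2%:R^-1 + (k.*2).+2%:R^-1 = k.+1%:R^-1 :> R.
  rewrite -doubleS -muln2 natrM invfM -splitr//.
exists (q, (k.*2).+1) => //= y /= yq; apply: eA; rewrite -ball_normE /=.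
apply: lt_trans ke; rewrite -k2 (le_lt_trans (ler_distD (map_mx ratr q) _ _))//.
by apply: ltrD => //; rewrite distrC.
Qed.

Lemma open_caratheodory A : open A -> measurable (A : set L).
Proof.
move=> /open_bigcup_rational_balls ->.
rewrite bigcup_mkcond; apply: countable_bigcupT_measurable => // p.
by case: ifP => _; [exact: norm_ball_measurable|exact: measurable0].
Qed.

Definition scale_set (r : R) A : set V := [set r *: x | x in A].

Lemma meas_scale_le (r : R) A : 0 < r ->
  (meas (scale_set r A) <= (r ^+ n.+1)%:E * meas A)%E.
Proof.
move=> r0; have rn0 : 0 < r ^+ n.+1 by rewrite exprn_gt0.
rewrite -lee_pdivrMl//; apply: le_ereal_inf_tmp => _ [a [b [ab Aab ->]]].
rewrite lee_pdivrMl// -nneseriesZl; last first.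
  by move=> k _; exact: box_volume_ge0.
rewrite (eq_eseriesr
  (g := fun k => (box_volume (r *: a k) (r *: b k))%:E)%E); last first.
  move=> k _; rewrite -EFinM; congr EFin.
  have -> : r ^+ n.+1 = \prod_(i < n.+1) r by rewrite prodr_const card_ord.
  rewrite /box_volume -big_split/=.
  by apply: eq_bigr => i _; rewrite !mxE mulrBr.
apply: meas_le_cover => [k i|_ [x Ax <-]].
  by rewrite !mxE ler_pM2l.
have [k _ xk] := Aab _ Ax; exists k => // i.
by rewrite !mxE !ler_pM2l.
Qed.

Lemma meas_scale (r : R) A : 0 < r ->
  meas (scale_set r A) = ((r ^+ n.+1)%:E * meas A)%E.
Proof.
move=> r0; have rn0 : 0 < r ^+ n.+1 by rewrite exprn_gt0.
apply/eqP; rewrite eq_le meas_scale_le//= -lee_pdivlMl// -exprVn.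
apply: le_trans (meas_scale_le _ _); rewrite ?invr_gt0//.
apply: meas_mono => x Ax; exists (r *: x); first by exists x.
by rewrite scalerA mulVf ?gt_eqF// scale1r.
Qed.

End LebesgueMeasurable.

(** * Euclidean norm and balls *)

Section EuclideanNorm.
Context {R : realType} {n : nat}.
Local Notation V := 'rV[R]_n.+1.
Local Notation L := (caratheodory_type (@meas R n.+1)).
Implicit Types (A : set V) (a b x : V).

Lemma enorm_ge0 x : 0 <= enorm x.
Proof. exact: sqrtr_ge0. Qed.


Lemma enormZ (r : R) x : 0 <= r -> enorm (r *: x) = r * enorm x.
Proof.
move=> r0; rewrite /enorm.
under eq_bigr do rewrite mxE exprMn.
by rewrite -mulr_sumr sqrtrM ?sqr_ge0// sqrtr_sqr ger0_norm.
Qed.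

Lemma normr_coord_le_enorm x i : `|x 0 i| <= enorm x.
Proof.
rewrite -sqrtr_sqr ler_wsqrtr// (bigD1 i)//= lerDl sumr_ge0// => j _.
exact: sqr_ge0.
Qed.

Lemma normr_le_enorm x : `|x| <= enorm x.
Proof.
rewrite {1}/Num.norm/= mx_normrE; apply: bigmax_le; first exact: enorm_ge0.
by move=> -[j i] _ /=; rewrite (ord1 j) normr_coord_le_enorm.
Qed.

Lemma enorm0 : enorm (0 : V) = 0.
Proof. by rewrite -(scale0r 0) enormZ// mul0r. Qed.

Lemma enorm_gt0 x : (0 < enorm x) = (x != 0).
Proof.
have [->|x0] := eqVneq x 0; first by rewrite enorm0 ltxx.
by rewrite (lt_le_trans _ (normr_le_enorm x))// normr_gt0.
Qed.

Lemma enorm_continuous : continuous (@enorm R n.+1).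
Proof.
have sum_sqr : continuous (fun x : V => \sum_(i < n.+1) x 0 i ^+ 2).
  apply: continuous_big => [|i _ x]; first exact: add_continuous.
  apply: (@continuous_comp _ _ _ (fun x : V => x 0 i) (fun t : R => t ^+ 2)).
    exact: coord_continuous.
  exact: exprn_continuous.
move=> x; apply: (@continuous_comp _ _ _ (fun x : V => \sum_(i < n.+1) x 0 i ^+ 2)).
  exact: sum_sqr.
exact: sqrt_continuous.
Qed.

Lemma eball_open (r : R) : open (eball r : set V).
Proof.
have -> : (eball r : set V) = @enorm R n.+1 @^-1` [set y | y < r] by [].
apply: open_comp; last exact: open_lt.
by move=> x _; exact: enorm_continuous.
Qed.

Lemma eball_measurable (r : R) : measurable (eball r : set L).
Proof. exact/open_caratheodory/eball_open. Qed.

Lemma meas_eball_lty (r : R) : (meas (eball r : set V) < +oo)%E.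
Proof.
pose c := `|r|.
apply: (@le_lt_trans _ _ (meas (box (const_mx (- c)) (const_mx c) : set V))).
  apply: meas_mono => x /= xr i; rewrite !mxE -ler_norml.
  rewrite (le_trans (normr_coord_le_enorm _ _))// (le_trans (ltW xr))//.
  exact: ler_norm.
apply: le_lt_trans (meas_box_le _) (ltry _) => i.
by rewrite !mxE ge0_cp// normr_ge0.
Qed.

Lemma eball_scale (r : R) : 0 < r -> eball r = scale_set r (eball 1) :> set V.
Proof.
move=> r0; apply/seteqP; split=> [x xr|_ [x x1 <-]] /=.
  exists (r^-1 *: x); last by rewrite scalerA mulfV ?gt_eqF// scale1r.
  by rewrite /eball/= enormZ ?invr_ge0 ?ltW// mulrC ltr_pdivrMr// mul1r.
by rewrite /eball/= enormZ ?ltW// gtr_pMr.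
Qed.

Lemma fine_meas_scale (r : R) A : 0 < r ->
  fine (meas (scale_set r A)) = r ^+ n.+1 * fine (meas A).
Proof.
move=> r0; have rn0 : 0 < r ^+ n.+1 by rewrite exprn_gt0.
rewrite meas_scale//; have := meas_ge0 A.
by case: (meas A) => [x||]//= _; rewrite gt0_muley ?lte_fin//= mulr0.
Qed.

End EuclideanNorm.

(** * Convergence sets and directions *)

Lemma open_lt_dist (R : realType) (T : topologicalType) (D : set T)
    (f : T -> R) (l e : R) :
  open D -> (forall x, D x -> {for x, continuous f}) ->
  open [set x | D x /\ `|l - f x| < e].
Proof.
move=> oD cf; rewrite openE => x [Dx xe].
have nD : \forall y \near x, D y by apply: open_nbhs_nbhs.
apply: filterI => //.
have : `|l - f y| @[y --> x] --> `|l - f x|.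
  by apply: cvg_norm; apply: cvgB; [exact: cvg_cst|exact: cf].
by move=> /cvgr_lt; exact.
Qed.

Lemma measurable_cvg_set (R : realType) (n : nat) (D : set 'rV[R]_n.+1)
    (u : nat -> 'rV[R]_n.+1 -> R) (l : R) :
  open D -> (forall k x, D x -> {for x, continuous (u k)}) ->
  measurable ([set x | D x /\ u k x @[k --> \oo] --> l]
    : set (caratheodory_type (@meas R n.+1))).
Proof.
move=> oD cu.
pose O k (p : nat) := [set x | D x /\ `|l - u k x| < p.+1%:R^-1].
have oO k p : open (O k p) by apply: open_lt_dist => // x; exact: cu.
rewrite (_ : [set _ | _] =
  \bigcap_p \bigcup_N \bigcap_(k in [set k | (N <= k)%N]) O k p).
  apply: bigcapT_measurable => p; apply: bigcupT_measurable => N.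
  by apply: bigcap_measurable => [|k _]; [exists N => /=|exact: open_caratheodory].
apply/seteqP; split => [x [Dx ux] p _|x ux].
  have p0 : 0 < p.+1%:R^-1 :> R by rewrite invr_gt0.
  have [N _ NP] := (cvgrPdist_lt _ _).1 ux _ p0.
  by exists N => // k Nk; split => //; exact: NP.
split; first by have [N _ /(_ N (leqnn N))[]] := ux 0%N I.
apply/cvgrPdist_lt => e e0; have [p pe] := ltr_add_invr e0.
rewrite add0r in pe; have [N _ NP] := ux p I.
by exists N => // k /NP[_ /lt_trans]; apply.
Qed.

Section Direction.
Context {R : realType} {n : nat}.
Local Notation V := 'rV[R]_n.+1.
Implicit Types (x : V).

(** Radial projection to the sphere; the value at the origin is arbitrary. *)
Definition direction x : sphere R n :=
  if pselect (unit_sphere ((enorm x)^-1 *: x)) is left h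
  then SigSub (mem_set h) else point.

Lemma val_direction x : x != 0 -> val (direction x) = (enorm x)^-1 *: x.
Proof.
rewrite -enorm_gt0 => x0; rewrite /direction; case: pselect => // -[].
by rewrite /unit_sphere/= enormZ ?invr_ge0 ?enorm_ge0// mulVf ?gt_eqF.
Qed.

Lemma enorm_sphere (z : sphere R n) : enorm (val z) = 1.
Proof. by case: z => x /= /set_mem. Qed.

Lemma sphere_neq0 (z : sphere R n) : val z != 0.
Proof. by rewrite -enorm_gt0 enorm_sphere. Qed.

Lemma direction_sphere (z : sphere R n) : direction (val z) = z.
Proof.
by apply: val_inj; rewrite val_direction ?sphere_neq0// enorm_sphere invr1 scale1r.
Qed.

Lemma enorm_scale_direction x : x != 0 -> x = enorm x *: val (direction x).
Proof.
by move=> x0; rewrite val_direction// scalerA mulfV ?scale1r// gt_eqF ?enorm_gt0.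
Qed.

Lemma directionZ (a : R) x : 0 < a -> direction (a *: x) = direction x.
Proof.
move=> a0; have [->|x0] := eqVneq x 0; first by rewrite scaler0.
apply: val_inj; rewrite !val_direction// ?scaler_eq0 ?(gt_eqF a0)//.
by rewrite enormZ ?ltW// scalerA invfM mulrAC mulVf ?mul1r ?gt_eqF.
Qed.

Lemma open_neq0 : open [set x : V | x != 0].
Proof.
have -> : [set x : V | x != 0] = @enorm R n.+1 @^-1` [set y | 0 < y].
  by apply/seteqP; split=> x /=; rewrite enorm_gt0.
apply: open_comp; last exact: open_gt.
by move=> x _; exact: enorm_continuous.
Qed.

Lemma direction_continuous x : x != 0 -> {for x, continuous direction}.
Proof.
move=> x0 U [W [[Q oQ <-] /= Qx QU]].
have : {for x, continuous (fun y : V => (enorm y)^-1 *: y)}.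
  apply: continuousZ => //; apply: continuousV; last exact: enorm_continuous.
  by rewrite gt_eqF ?enorm_gt0.
have Qx' : Q ((enorm x)^-1 *: x) by rewrite -val_direction.
move=> /(_ _ (open_nbhs_nbhs (conj oQ Qx'))) /=.
have : \forall y \near x, y != 0.
  by apply: open_nbhs_nbhs; split => //; exact: open_neq0.
apply: filterS2 => y y0 /= Qy; apply: QU => /=.
by rewrite set_valE val_direction.
Qed.
End Direction.

(** * Separating measures on the sphere by continuous functions *)

Lemma continuous_cst_sub_dist (R : realType) (V : normedModType R)
    (T : topologicalType) (f : T -> V) (r : R) (q : V) :
  continuous f -> continuous (fun z => r - `|f z - q|).
Proof.
move=> cf z; apply: cvgB; first exact: cvg_cst.
apply: cvg_norm; apply: cvgB; last exact: cvg_cst.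
exact: cf.
Qed.

Section SphereMeasures.
Context {R : realType} {n : nat}.
Local Notation S := (sphere R n).
Local Notation Sb := (borel_sphere R n).
Implicit Types (mu nu : probability Sb R) (phi h : S -> R).

Lemma continuous_borel_measurable phi :
  continuous phi -> measurable_fun [set: Sb] (phi : Sb -> R).
Proof.
move=> /continuousP cphi.
apply: (measurability _ (RGenOpens.measurableE R)).
move=> _ [_ [a [b ->]] <-]; rewrite setTI.
by apply: sub_sigma_algebra; apply: cphi; exact: interval_open.
Qed.

(** As k grows, these continuous functions increase to the indicator function of
    the positive half-line, so that the measure of [[set z | 0 < h z]] is a limit
    of integrals of continuous functions when [h] is continuous. *)
Definition ramp (k : nat) (t : R) : R := Num.min 1 (k%:R * Num.max 0 t).

Lemma ramp_ge0 k t : 0 <= ramp k t.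
Proof. by rewrite /ramp le_min ler01 mulr_ge0// le_max lexx. Qed.

Lemma ramp_le1 k t : ramp k t <= 1.
Proof. by rewrite /ramp ge_min lexx. Qed.

Lemma ramp_nondecreasing k l t : (k <= l)%N -> ramp k t <= ramp l t.
Proof.
move=> kl; rewrite /ramp le_min !ge_min lexx/=; apply/orP; right.
by rewrite ler_wpM2r ?le_max ?lexx// ler_nat.
Qed.

Lemma ramp_cvg t : ramp k t @[k --> \oo] --> ((0 < t)%R%:R : R).
Proof.
have [t0|t0] := ltP 0 t; last first.
  by apply: cvg_near_cst; near=> k; rewrite /ramp max_l// mulr0 min_r.
apply: cvg_near_cst; near=> k.
rewrite /ramp max_r ?ltW// min_l// -ler_pdivrMr// div1r.
by near: k; exact: nbhs_infty_ger.
Unshelve. all: by end_near. Qed.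

Lemma ramp_continuous k : continuous (ramp k).
Proof.
move=> t.
have c (a : R^o) : {for t, continuous (fun=> a)} by exact: cvg_cst.
have max_cont : {for t, continuous ((fun=> 0) \max (fun u => u : R^o))}.
  by apply: continuous_max; [exact: c|exact: cvg_id].
exact: (continuous_min (c 1) (continuousM (c k%:R) max_cont)).
Qed.

Lemma ramp_comp_measurable k h : continuous h ->
  measurable_fun [set: Sb] (EFin \o (fun z : Sb => ramp k (h z))).
Proof.
move=> ch; apply/measurable_EFinP.
apply: (@continuous_borel_measurable (fun z => ramp k (h z))) => z.
by apply: continuous_comp; [exact: ch|exact: ramp_continuous].
Qed.

Lemma borel_superlevel h : continuous h ->
  measurable ([set z | 0 < h z] : set Sb).
Proof.
move=> ch; have := continuous_borel_measurable ch measurableT (measurable_itv `]0, +oo[).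
rewrite setTI; congr measurable; apply/seteqP.
by split=> z /=; rewrite in_itv/= andbT.
Qed.

Lemma integral_ramp_cvg mu h : continuous h ->
  (\int[mu]_z (EFin \o (fun z : Sb => ramp k (h z))) z @[k --> \oo]
    --> mu [set z | (0 < h z)%R])%E.
Proof.
move=> ch.
have mU := borel_superlevel ch.
have := @cvg_monotone_convergence _ _ _ mu setT measurableT
  (fun k => EFin \o (fun z : Sb => ramp k (h z))) (fun k => ramp_comp_measurable k ch).
rewrite (_ : integral mu _ (fun x => limn _) = mu [set z | 0 < h z]).
  apply; first by move=> k z _; rewrite lee_fin ramp_ge0.
  by move=> z _ k l kl; rewrite lee_fin ramp_nondecreasing.
rewrite -[in RHS](setIT [set z | _]) -integral_indic//; apply: eq_integral => z _.
apply/cvg_lim => //; apply: cvg_EFin; first exact: nearW.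
rewrite indicE; have -> : (z \in [set z | 0 < h z]) = (0 < h z).
  by apply/idP/idP => [/set_mem|/mem_set].
exact: ramp_cvg.
Qed.

Lemma probability_setT_lty mu : (mu setT < +oo)%E.
Proof. by rewrite probability_setT ltry. Qed.

Lemma integral_ramp_fin_num mu k h : continuous h ->
  (\int[mu]_z (EFin \o (fun z : Sb => ramp k (h z))) z)%E \is a fin_num.
Proof.
move=> ch; rewrite ge0_fin_numE; last first.
  by apply: integral_ge0 => z _; rewrite lee_fin ramp_ge0.
apply: (@le_lt_trans _ _ (\int[mu]_z (cst 1 z))%E); last first.
  rewrite integral_cst// mul1e; exact: probability_setT_lty.
apply: ge0_le_integral => //.
- by move=> z _; rewrite lee_fin ramp_ge0.
- exact: ramp_comp_measurable.
- by move=> z _; rewrite lee_fin ramp_le1.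
Qed.

(** The trace on the sphere of the ball of centre q and radius r is the
    superlevel set of z |-> r - |z - q|, and countably many such traces cover
    any open set. *)
Lemma open_superlevels (U : set S) : open U ->
  <<s [set A : set S | exists2 h : S -> R, continuous h & A = [set z | 0 < h z]] >> U.
Proof.
move=> [Q oQ <-].
rewrite (open_bigcup_rational_balls oQ) preimage_bigcup bigcup_mkcond.
set G := [set A : set S | _].
apply: (@countable_bigcupT_measurable _ (g_sigma_algebraType G)) => // p.
case: ifP => _; last exact: measurable0.
apply: sub_sigma_algebra.
exists (fun z => p.2.+1%:R^-1 - `|val z - map_mx ratr p.1|); last first.
  by apply/seteqP; split=> z /=; rewrite subr_gt0.
have val_cont : continuous (val : S -> 'rV[R]_n.+1) by exact: initial_continuous.
exact: continuous_cst_sub_dist.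
Qed.

(** The sets [[set z | 0 < h z]] with [h] continuous form a pi-system, because
    the minimum of two continuous functions is continuous; they generate the
    Borel sets, and the measures agree on them by monotone convergence. *)
Lemma probability_eq_continuous mu nu :
  (forall phi, continuous phi -> (\int[mu]_z phi z = \int[nu]_z phi z)%R) ->
  forall A : set Sb, measurable A -> mu A = nu A.
Proof.
move=> munu.
pose G := [set A : set Sb | exists2 h : S -> R, continuous h & A = [set z | 0 < h z]].
move=> A mA; apply: (@g_sigma_algebra_measure_unique _ _ _ G _ (fun=> setT)) => //.
- by move=> _ [h ch ->]; exact: borel_superlevel.
- by move=> _; exists (fun=> 1); [exact: cst_continuous|apply/seteqP; split => z //= _].
- by rewrite bigcup_const.
- move=> _ _ [h ch ->] [h' ch' ->]; exists (fun z => Num.min (h z) (h' z)).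
    by move=> z; apply: continuous_min; [exact: ch|exact: ch'].
  by apply/seteqP; split => z /=; rewrite lt_min => /andP.
- move=> _ [h ch ->].
  suff E : mu [set z | 0 < h z] = nu [set z | 0 < h z] by exact: E.
  rewrite -(cvg_lim (@ereal_hausdorff R) (@integral_ramp_cvg mu h ch)).
  rewrite -(cvg_lim (@ereal_hausdorff R) (@integral_ramp_cvg nu h ch)).
  congr (limn _); apply/funext => k.
  rewrite -[LHS](fineK (@integral_ramp_fin_num mu k h ch)).
  rewrite -[RHS](fineK (@integral_ramp_fin_num nu k h ch)); congr EFin.
  apply: (munu (fun z => ramp k (h z))) => z.
  by apply: continuous_comp; [exact: ch|exact: ramp_continuous].
- by move=> k; exact: probability_setT_lty.
- move: A mA; apply: smallest_sub; first exact: smallest_sigma_algebra.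
  exact: open_superlevels.
Qed.

Lemma distinct_measures_separated mu nu : distinct_measures mu nu ->
  exists2 phi : S -> R, continuous phi &
    (\int[mu]_z phi z)%R != (\int[nu]_z phi z)%R.
Proof.
case=> A mA /eqP munuA; apply/not_exists2P => munu; apply: munuA.
apply: probability_eq_continuous => // phi cphi; apply/eqP.
by case: (munu phi) => // /negP/negPn.
Qed.

End SphereMeasures.

(** * Orbits of a homogeneous map *)

Lemma continuous_average (R : realType) (T : topologicalType)
    (f : nat -> T -> R) (k : nat) (x : T) :
  (forall i, {for x, continuous (f i)}) ->
  {for x, continuous (fun y => k%:R^-1 * \sum_(0 <= i < k) f i y)}.
Proof.
move=> cf; apply: cvgM; first exact: cvg_cst.
apply: cvg_big => [|i _]; last exact: cf.
exact: add_continuous.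
Qed.

Section HomogeneousDynamics.
Context {R : realType} {n : nat}.
Local Notation V := 'rV[R]_n.+1.
Local Notation S := (sphere R n).
Local Notation L := (caratheodory_type (@meas R n.+1)).
Context (g : V -> V) (g_cont : continuous g) (g_hom : linearly_homogeneous g).
Context (g_eq0 : forall x, g x = 0 -> x = 0).
Implicit Types (x : V) (phi : S -> R).

Lemma homogeneous_at0 : g 0 = 0.
Proof. by have := @g_hom 0 0 (lexx 0); rewrite !scale0r. Qed.

Lemma iter_continuous k : continuous (iter k g).
Proof.
elim: k => [|k IH] x /=; first exact: cvg_id.
by apply: continuous_comp; [exact: IH|exact: g_cont].
Qed.

Lemma iter_homogeneous k : linearly_homogeneous (iter k g).
Proof. by move=> a x a0; elim: k => //= k ->; rewrite g_hom. Qed.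

Lemma iter_neq0 k x : x != 0 -> iter k g x != 0.
Proof. by move=> x0; elim: k => //= k; apply: contra_neq => /g_eq0. Qed.

(** The function ln D, whose integral is [lambda g]. *)
Definition growth (z : S) : R := ln (enorm (g (val z))).

Lemma growth_continuous : continuous growth.
Proof.
have val_cont : continuous (val : S -> V) by exact: initial_continuous.
move=> z; apply: (@continuous_comp _ _ _ (fun z : S => enorm (g (val z))) (@ln R)).
  apply: (@continuous_comp _ _ _ (fun z : S => g (val z)) (@enorm R n.+1)).
    by apply: continuous_comp; [exact: val_cont|exact: g_cont].
  exact: enorm_continuous.
apply: continuous_ln; rewrite enorm_gt0.
by apply: contra_neq (sphere_neq0 z) => /g_eq0.
Qed.

(** The Birkhoff average of [phi] along the orbit of [direction x] under the map
    induced on the sphere, expressed with the iterates of [g] so that it is a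
    function of the vector [x], continuous away from the origin. *)
Definition orbit_average phi k x : R :=
  k%:R^-1 * \sum_(0 <= i < k) phi (direction (iter i g x)).

Lemma orbit_average_continuous phi k x : continuous phi -> x != 0 ->
  {for x, continuous (orbit_average phi k)}.
Proof.
move=> cphi x0.
have c i : {for x, continuous (fun y => phi (direction (iter i g y)))}.
  apply: (@continuous_comp _ _ _ (iter i g) (phi \o direction)).
    exact: iter_continuous.
  apply: continuous_comp; last exact: cphi.
  exact/direction_continuous/iter_neq0.
exact: (@continuous_average _ _ (fun i y => phi (direction (iter i g y)))).
Qed.

Lemma orbit_averageZ phi k (a : R) x : 0 < a ->
  orbit_average phi k (a *: x) = orbit_average phi k x.
Proof.
move=> a0; congr (_ * _); apply: eq_bigr => i _.
by rewrite iter_homogeneous ?ltW// directionZ.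
Qed.

(** Each application of [g] multiplies the norm by the value of D at the current
    direction. *)
Lemma enorm_iter k x : x != 0 ->
  enorm (iter k g x) = enorm x * expR (k%:R * orbit_average growth k x).
Proof.
move=> x0; rewrite /orbit_average.
have -> : k%:R * (k%:R^-1 * \sum_(0 <= i < k) growth (direction (iter i g x)))
    = \sum_(0 <= i < k) growth (direction (iter i g x)).
  case: k => [|k]; first by rewrite big_geq// !mulr0.
  by rewrite mulrA mulfV ?mul1r.
elim: k => [|k IH]; first by rewrite big_geq// expR0 mulr1.
rewrite big_nat_recr//= expRD mulrA -IH /growth lnK; last first.
  rewrite posrE enorm_gt0; apply: contra_neq (sphere_neq0 (direction (iter k g x))).
  exact: g_eq0.
rewrite {1}(enorm_scale_direction (iter_neq0 k x0)).
by rewrite g_hom ?enorm_ge0// enormZ ?enorm_ge0.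
Qed.

Lemma iter_cvg0P x : (fun k => iter k g x) @ \oo --> (0 : V) <->
  enorm (iter k g x) @[k --> \oo] --> 0.
Proof.
split => [gx|gx].
  rewrite -(@enorm0 R n).
  by apply: (cvg_comp _ _ gx); exact: enorm_continuous.
apply/norm_cvg0P; apply: (squeeze_cvgr _ (cvg_cst 0) gx).
by apply: nearW => k; rewrite normr_ge0 normr_le_enorm.
Qed.

(** Eventually the average is below l / 2, and then the k-th norm is at most
    ||x|| exp(l / 2)^k. *)
Lemma iter_cvg0 x (l : R) : x != 0 -> l < 0 ->
  orbit_average growth k x @[k --> \oo] --> l ->
  (fun k => iter k g x) @ \oo --> (0 : V).
Proof.
move=> x0 l0 avg; apply/iter_cvg0P.
pose q := expR (l / 2).
have q1 : `|q| < 1 by rewrite ger0_norm ?expR_ge0// expR_lt1; lra.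
have bound0 : enorm x * q ^+ k @[k --> \oo] --> 0.
  rewrite -[X in _ --> X](mulr0 (enorm x)).
  by apply: cvgM; [exact: cvg_cst|exact: cvg_expr].
apply: (squeeze_cvgr _ (cvg_cst 0) bound0).
have : \forall k \near \oo, orbit_average growth k x < l / 2.
  by move/cvgr_lt: avg; apply; lra.
apply: filterS => k avgk; rewrite enorm_ge0/= enorm_iter// -expRM_natl.
rewrite ler_wpM2l ?enorm_ge0// ler_expR ler_wpM2l ?ler0n//.
exact: ltW.
Qed.

(** Eventually the average is positive, and then the norm is at least ||x||. *)
Lemma iter_ncvg0 x (l : R) : x != 0 -> 0 < l ->
  orbit_average growth k x @[k --> \oo] --> l ->
  ~ (fun k => iter k g x) @ \oo --> (0 : V).
Proof.
move=> x0 l0 avg /iter_cvg0P gx0.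
suff : enorm x <= 0 by rewrite leNgt enorm_gt0 x0.
apply: (cvgr_to_ge gx0).
have : \forall k \near \oo, 0 < orbit_average growth k x.
  by move/cvgr_gt: avg; apply.
apply: filterS => k avgk.
rewrite enorm_iter// ler_peMr ?enorm_ge0// -expR0 ler_expR.
by rewrite mulr_ge0// ltW.
Qed.

End HomogeneousDynamics.

(** * Measure of sets in a ball and of cones *)

Section ConicMeasure.
Context {R : realType} {n : nat}.
Local Notation V := 'rV[R]_n.+1.
Local Notation L := (caratheodory_type (@meas R n.+1)).
Implicit Types (A B W : set V) (x : V).

Lemma meas_sub_eball_fin_num A (r : R) : A `<=` eball r -> meas A \is a fin_num.
Proof.
move=> Ar; rewrite ge0_fin_numE ?meas_ge0//.
exact: le_lt_trans (meas_mono Ar) (meas_eball_lty r).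
Qed.

Lemma fine_meas_mono A B (r : R) : A `<=` B -> B `<=` eball r ->
  fine (meas A) <= fine (meas B).
Proof.
move=> AB Br; apply: fine_le; last exact: meas_mono.
  exact: meas_sub_eball_fin_num (subset_trans AB Br).
exact: meas_sub_eball_fin_num Br.
Qed.

Lemma fine_meas_ge0 A : 0 <= fine (meas A).
Proof. by rewrite fine_ge0// meas_ge0. Qed.

Lemma fine_meas_disjoint_le m (P : pred 'I_m) (F : 'I_m -> set V) A (r : R) :
  (forall i, measurable (F i : set L)) ->
  (forall i j, i != j -> F i `&` F j = set0) ->
  (forall i, P i -> F i `<=` A) -> A `<=` eball r ->
  \sum_(i < m | P i) fine (meas (F i)) <= fine (meas A).
Proof.
move=> mF disj FA Ar.
rewrite -lee_fin (fineK (meas_sub_eball_fin_num Ar)) -sumEFin.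
rewrite (eq_bigr (fun i => meas (F i))); last first.
  by move=> i Pi; rewrite fineK// (meas_sub_eball_fin_num (subset_trans (FA _ Pi) Ar)).
rewrite -(@measure_bigsetU_ord _ _ _ (lebesgue R n) m P F)//; last first.
  by apply/trivIsetP => i j _ _; exact: disj.
apply: meas_mono; elim/big_ind : _ => [//|B C BA CA x [/BA|/CA]//|i].
exact: FA.
Qed.

Definition unit_cone (Om : set (sphere R n)) : set V :=
  [set x | exists a (z : sphere R n), [/\ Om z, 0 <= a <= 1 & x = a *: val z]].

(** The unit cone over [Om] is closed on the outside whereas the ball is open,
    and it may contain the origin.  The origin is a null set, and for r > 1 the
    remainder lies in the r-scaled trace of [W] on the open ball; let r tend
    to 1. *)
Lemma meas_unit_cone_le (Om : set (sphere R n)) W :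
    (forall (a : R) x, 0 < a -> W x -> W (a *: x)) ->
    (forall z, Om z -> W (val z)) ->
  fine (meas (unit_cone Om)) <= fine (meas (W `&` eball 1)).
Proof.
move=> WZ OmW; set M := fine (meas (W `&` eball 1)).
have M0 : (meas (W `&` eball 1) = M%:E)%E.
  by rewrite /M fineK// (@meas_sub_eball_fin_num _ 1).
have bound (r : R) : 1 < r -> (meas (unit_cone Om) <= (r ^+ n.+1 * M)%:E)%E.
  move=> r1; have r0 : 0 < r by lra.
  rewrite EFinM -M0 -meas_scale// -[leRHS]add0e -(meas_set1 (0 : V)).
  apply: le_trans (outer_measureU2 _ _ _).
  apply: meas_mono => _ [a [z [Omz /andP[a0 a1] ->]]].
  have [->|an0] := eqVneq a 0; first by left; rewrite /= scale0r.
  have {an0}a0 : 0 < a by rewrite lt_def an0.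
  right; exists ((a / r) *: val z); last by rewrite scalerA mulrCA mulfV ?mulr1// gt_eqF.
  split; first by apply: WZ; [rewrite divr_gt0|exact: OmW].
  rewrite /eball/= enormZ ?divr_ge0 ?ltW// enorm_sphere mulr1 ltr_pdivrMr//; lra.
have fin : meas (unit_cone Om) \is a fin_num.
  rewrite ge0_fin_numE ?meas_ge0//; apply: le_lt_trans (bound 2 _) (ltry _).
  lra.
have lim : (r ^+ n.+1 * M) @[r --> 1^'+] --> (1 : R) ^+ n.+1 * M.
  apply: cvgM; last exact: cvg_cst.
  by apply: cvg_at_right_filter; exact: exprn_continuous.
rewrite expr1n mul1r in lim.
apply: (cvgr_to_ge lim); near=> r.
by rewrite -lee_fin fineK// bound.
Unshelve. all: by end_near. Qed.

End ConicMeasure.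

(** * Converging cones and stable sets *)

Section StableSets.
Context {R : realType} {n : nat}.
Local Notation V := 'rV[R]_n.+1.
Local Notation S := (sphere R n).
Local Notation L := (caratheodory_type (@meas R n.+1)).
Context (g : V -> V) (g_cont : continuous g) (g_hom : linearly_homogeneous g).
Context (g_eq0 : forall x, g x = 0 -> x = 0).
Implicit Types (x : V) (phi : S -> R).

(** For [phi] a finite family of test functions and [c] their integrals for a
    measure, this cone is a measurable substitute for the cone over the basin of
    that measure. *)
Definition converging_cone (J : finType) (phi : J -> S -> R) (c : J -> R) : set V :=
  [set x | x != 0 /\
    forall a, orbit_average g (phi a) k x @[k --> \oo] --> c a].

Lemma measurable_converging_cone (J : finType) (phi : J -> S -> R) (c : J -> R) :
  (forall a, continuous (phi a)) ->
  measurable (converging_cone phi c : set L).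
Proof.
move=> cphi.
have -> : converging_cone phi c = [set x | x != 0] `&` \bigcap_(a in [set: J])
    [set x | x != 0 /\ orbit_average g (phi a) k x @[k --> \oo] --> c a].
  apply/seteqP; split=> x [x0 xc].
    by split.
  by split=> // a; case: (xc a I).
apply: measurableI; first by apply: open_caratheodory; exact: open_neq0.
apply: fin_bigcap_measurable => // a _.
apply: (measurable_cvg_set _ open_neq0) => k x x0.
exact: orbit_average_continuous.
Qed.

Lemma converging_coneZ (J : finType) (phi : J -> S -> R) (c : J -> R) (a : R) x :
  0 < a -> converging_cone phi c x -> converging_cone phi c (a *: x).
Proof.
move=> a0 [x0 xc]; split; first by rewrite scaler_eq0 negb_or (gt_eqF a0).
by move=> i; under eq_fun do rewrite orbit_averageZ//; exact: xc.
Qed.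

Lemma converging_cone_disjoint (J : finType) (phi : J -> S -> R) (c c' : J -> R) a :
  c a != c' a -> converging_cone phi c `&` converging_cone phi c' = set0.
Proof.
move=> /eqP cc'; rewrite -subset0 => x [[_ xc] [_ xc']]; apply: cc'.
exact: cvg_unique (xc a) (xc' a).
Qed.

Lemma basin_converging_cone (G : S -> S)
    (G_def : forall z, val (G z) = (enorm (g (val z)))^-1 *: g (val z))
    (mu : probability (borel_sphere R n) R)
    (J : finType) (phi : J -> S -> R) :
  (forall a, continuous (phi a)) ->
  forall z, basin G mu z ->
    converging_cone phi (fun a => (\int[mu]_z phi a z)%R) (val z).
Proof.
move=> cphi z zmu; split=> [|a]; first exact: sphere_neq0.
have G_iter i : direction (iter i g (val z)) = iter i G z.
  elim: i => [|i IH] /=; first exact: direction_sphere.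
  rewrite -IH; have y0 := iter_neq0 g_eq0 i (sphere_neq0 z).
  set y := iter i g (val z) in y0 *.
  have gy0 : g y != 0 by apply: contra_neq y0 => /g_eq0.
  apply: val_inj; rewrite G_def -val_direction; last first.
    by apply: contra_neq (sphere_neq0 (direction y)) => /g_eq0.
  by rewrite [in LHS](enorm_scale_direction y0) g_hom ?enorm_ge0// directionZ ?enorm_gt0.
have -> : (fun k => orbit_average g (phi a) k (val z)) =
    (fun k => k%:R^-1 * \sum_(0 <= i < k) phi a (iter i G z)).
  apply/funext => k; congr (_ * _).
  by apply: eq_bigr => i _; rewrite G_iter.
exact: zmu (cphi a).
Qed.

Lemma measurable_stable_set (e r : R) : measurable (stable_set g e r : set L).
Proof.
have -> : stable_set g e r = eball r `&`
    [set x | [set: V] x /\ enorm (iter k g x) @[k --> \oo] --> 0] `&`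
    \bigcap_k (iter k g @^-1` eball e).
  apply/seteqP; split=> x.
    by case=> xr /iter_cvg0P gx ge; split => // k _; exact: ge.
  by case=> -[xr [_ /iter_cvg0P gx]] ge; split => // k; exact: ge.
apply: measurableI; first apply: measurableI.
- exact: eball_measurable.
- apply: (measurable_cvg_set _ openT) => k x _.
  by apply: continuous_comp; [exact: iter_continuous|exact: enorm_continuous].
- apply: bigcapT_measurable => k; apply: open_caratheodory.
  apply: open_comp; last exact: eball_open.
  by move=> x _; exact: iter_continuous.
Qed.

Lemma stable_set_scale (e r : R) : 0 < r ->
  stable_set g e r = scale_set r (stable_set g (e / r) 1).
Proof.
move=> r0.
have H a (x : V) s t : 0 < a -> stable_set g s t x -> stable_set g (a * s) (a * t) (a *: x).
  move=> a0 [xt gx gs]; split.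
  - by rewrite /eball/= enormZ ?ltW// ltr_pM2l.
  - under eq_fun do rewrite (iter_homogeneous g_hom) ?ltW//.
    by rewrite -(scaler0 _ a); apply: cvgZ; [exact: cvg_cst|exact: gx].
  - move=> k; rewrite /eball/= (iter_homogeneous g_hom) ?ltW//.
    rewrite enormZ ?ltW// ltr_pM2l//.
    exact: gs.
apply/seteqP; split=> [x xs|_ [x xs <-]].
  exists (r^-1 *: x); last by rewrite scalerA mulfV ?scale1r// gt_eqF.
  have := H r^-1 x e r; rewrite invr_gt0 mulVf ?gt_eqF// mulrC; exact.
have := H r x (e / r) 1 r0 xs.
by rewrite mulr1 mulrCA mulfV ?gt_eqF// mulr1.
Qed.

Definition attracted : set V :=
  [set x | eball 1 x /\ (fun k => iter k g x) @ \oo --> (0 : V)].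

(** A convergent orbit is bounded, hence stays in the ball of radius k for some
    integer k. *)
Lemma bigcup_stable_set : \bigcup_k stable_set g k%:R 1 = attracted.
Proof.
apply/seteqP; split=> [x [k _ []]//|x [x1 gx]].
have /iter_cvg0P/cvgP/cvg_seq_bounded := gx.
move=> [M [_ HM]].
have [k Mk] : exists k : nat, M + 1 < k%:R.
  by exists (Num.truncn (M + 1)).+1; exact: truncnS_gt.
exists k => //; split => // i; rewrite /eball/=.
apply: le_lt_trans Mk; have := HM (M + 1) _ i I; rewrite ltrDl ltr01 => /(_ isT).
exact/le_trans/ler_norm.
Qed.

Lemma measurable_attracted : measurable (attracted : set L).
Proof.
rewrite -bigcup_stable_set; apply: bigcupT_measurable => k.
exact: measurable_stable_set.
Qed.

Lemma stable_set_mono (e e' r : R) : e <= e' -> stable_set g e r `<=` stable_set g e' r.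
Proof.
by move=> ee' x [xr gx ge]; split => // k; apply: lt_le_trans ee'; exact: ge.
Qed.

Lemma fine_meas_stable_set_cvg :
  fine (meas (stable_set g k%:R 1)) @[k --> \oo] --> fine (meas attracted).
Proof.
apply: fine_cvg; rewrite fineK; last first.
  by apply: (@meas_sub_eball_fin_num _ _ _ 1) => x [].
rewrite -bigcup_stable_set.
apply: (@nondecreasing_cvg_mu _ _ _ (lebesgue R n) (fun k => stable_set g k%:R 1)).
- by move=> k; exact: measurable_stable_set.
- by apply: bigcupT_measurable => k; exact: measurable_stable_set.
- by move=> k l kl; apply/subsetPset/stable_set_mono; rewrite ler_nat.
Qed.

(** Scaling by 1 / r turns the density at radius r into the density in the unit
    ball of the stable set for e / r, and e / r tends to infinity. *)
Lemma stable_density_cvg (e : R) : 0 < e ->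
  fine (meas (stable_set g e r)) / fine (meas (eball r : set V)) @[r --> 0^'+]
    --> fine (meas attracted) / fine (meas (eball 1 : set V)).
Proof.
move=> e0.
have lim : fine (meas (stable_set g (e / r) 1)) @[r --> 0^'+] --> fine (meas attracted).
  apply/cvgrPdist_lt => d d0.
  have [k _ Hk] := (cvgrPdist_lt _ _).1 fine_meas_stable_set_cvg _ d0.
  have {}Hk := Hk k (leqnn k).
  have ek : 0 < e / k.+1%:R by rewrite divr_gt0.
  near=> r.
  have r0 : 0 < r by near: r; exact: nbhs_right_gt.
  have kr : k%:R <= e / r.
    rewrite ler_pdivlMr//; apply: (@le_trans _ _ (k.+1%:R * r)).
      by rewrite ler_pM2r// ler_nat.
    rewrite mulrC -ler_pdivlMr//.
    by near: r; exact: nbhs_right_le.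
  have sub s : stable_set g s 1 `<=` attracted by move=> x [].
  have att1 : attracted `<=` eball 1 by move=> x [].
  have lo := fine_meas_mono (stable_set_mono kr (r := 1)) (subset_trans (sub _) att1).
  have hi := fine_meas_mono (sub (e / r)) att1.
  rewrite ger0_norm ?subr_ge0//; apply: le_lt_trans Hk.
  by rewrite (le_trans _ (ler_norm _))// lerB.
have : fine (meas (stable_set g (e / r) 1)) / fine (meas (eball 1 : set V)) @[r --> 0^'+]
    --> fine (meas attracted) / fine (meas (eball 1 : set V)).
  by apply: cvgM => //; exact: cvg_cst.
apply: cvg_trans; apply: near_eq_cvg; near=> r.
have r0 : 0 < r by near: r; exact: nbhs_right_gt.
rewrite (stable_set_scale e r0) (eball_scale r0) !fine_meas_scale//.
by rewrite -mulf_div mulfV ?mul1r// gt_eqF// exprn_gt0.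
Unshelve. all: by end_near. Qed.

End StableSets.

(** * Stability of the origin *)

Lemma sum_eq_of_le (R : numDomainType) (I : finType) (a b : I -> R) :
  (forall i, a i <= b i) -> \sum_i b i <= \sum_i a i -> forall i, a i = b i.
Proof.
move=> ab ba i; apply/esym/eqP; rewrite -subr_eq0; apply/eqP.
have /psumr_eq0P : \sum_i (b i - a i) = 0.
  apply/eqP; rewrite eq_le sumr_ge0 ?andbT.
    by rewrite sumrB subr_le0.
  by move=> j _; rewrite subr_ge0.
by apply => // j _; rewrite subr_ge0.
Qed.

Lemma fine_meas_setDK (R : realType) (n : nat)
    (A : set 'rV[R]_n.+1) (r : R) :
  measurable (A : set (caratheodory_type (@meas R n.+1))) -> A `<=` eball r ->
  fine (meas A) + fine (meas (eball r `\` A)) = fine (meas (eball r : set 'rV[R]_n.+1)).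
Proof.
move=> mA Ar; rewrite -fineD.
- by rewrite [in RHS](mA (eball r)) setIidr// setDE.
- exact: meas_sub_eball_fin_num Ar.
- exact: (@meas_sub_eball_fin_num _ _ _ r).
Qed.

Theorem theorem4p1 (R : realType) (n : nat) (hd : (2 <= n.+1)%N)
    (g : 'rV[R]_n.+1 -> 'rV[R]_n.+1)
    (g_cont : continuous g)
    (g_hom : linearly_homogeneous g)
    (g_eq0 : forall x, g x = 0 -> x = 0)
    (G : sphere R n -> sphere R n)
    (G_def : forall z : sphere R n,
      val (G z) = (enorm (g (val z)))^-1 *: g (val z))
    (m : nat) (mu : 'I_m -> probability (borel_sphere R n) R)
    (mu_distinct : forall i j, i != j -> distinct_measures (mu i) (mu j))
    (mu_physical : forall j, physical_measure G (mu j))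
    (basins_full : \sum_(j < m) spherical_measure (basin G (mu j)) = 1)
    (lambda_neq0 : forall j, lambda g (mu j) != 0) :
  measure_stable_fixed_point g
    (\sum_(j < m | lambda g (mu j) < 0) spherical_measure (basin G (mu j))).
Proof.
split; first exact: homogeneous_at0.
set V := fine (meas (eball 1 : set 'rV[R]_n.+1)).
(* A null ball would make all spherical measures vanish, since division by 0
   gives 0, whereas they add up to 1. *)
have V0 : 0 < V.
  rewrite lt_def fine_meas_ge0 andbT; apply/eqP => V0.
  move: basins_full; rewrite big1 => [/esym/eqP|j _]; first by rewrite oner_eq0.
  by rewrite /spherical_measure -/V V0 invr0 mulr0.
have separate (p : 'I_m * 'I_m) : exists f : sphere R n -> R,
    continuous f /\ (p.1 != p.2 ->
      (\int[mu p.1]_z f z)%R != (\int[mu p.2]_z f z)%R).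
  have [->|] := eqVneq p.1 p.2.
    by exists (fun=> 0); split => //; exact: cst_continuous.
  by move=> /mu_distinct/distinct_measures_separated[f cf fij]; exists f.
have [psi psiP] := choice separate.
(* The test functions: [None] stands for ln D, [Some (i, j)] for a function
   that separates [mu i] from [mu j]. *)
pose phi (a : option ('I_m * 'I_m)) := if a is Some p then psi p else growth g.
have phi_cont a : continuous (phi a).
  by case: a => [p|] /=; [case: (psiP p)|exact: growth_continuous].
pose c j a := (\int[mu j]_z phi a z)%R.
pose W j := converging_cone g phi (c j).
pose w j := fine (meas (W j `&` eball 1)).
have mW j : measurable (W j `&` eball 1 : set (caratheodory_type (@meas R n.+1))).
  by apply: measurableI; [exact: measurable_converging_cone|exact: eball_measurable].
have W_disjoint i j : i != j -> (W i `&` eball 1) `&` (W j `&` eball 1) = set0.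
  move=> ij; rewrite setIACA (@converging_cone_disjoint _ _ _ _ _ _ _ (Some (i, j))) ?set0I//.
  by case: (psiP (i, j)) => _; apply.
have basin_le j : spherical_measure (basin G (mu j)) <= w j / V.
  rewrite /spherical_measure -/V; apply: ler_wpM2r; first by rewrite invr_ge0 ltW.
  apply: (@meas_unit_cone_le _ _ _ (W j)).
    by move=> a x; exact: converging_coneZ.
  exact: basin_converging_cone.
have w_sum : \sum_j w j <= V.
  by apply: (@fine_meas_disjoint_le _ _ _ _ _ _ 1) => // i _ x [].
have basinE j : spherical_measure (basin G (mu j)) = w j / V.
  apply: (sum_eq_of_le basin_le).
  by rewrite basins_full -mulr_suml ler_pdivrMr// mul1r.
have w_full : \sum_j w j = V.
  move: basins_full; under eq_bigr do rewrite basinE.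
  by rewrite -mulr_suml => /divr1_eq.
have w_contracting : \sum_(j | lambda g (mu j) < 0) w j <= fine (meas (attracted g)).
  apply: (@fine_meas_disjoint_le _ _ _ _ _ _ 1) => [//|//|j lj x [[x0 xc] x1]|x []//].
  by split => //; exact: iter_cvg0 x0 lj (xc None).
have w_expanding : \sum_(j | ~~ (lambda g (mu j) < 0)) w j
    <= fine (meas (eball 1 `\` attracted g)).
  apply: (@fine_meas_disjoint_le _ _ _ _ _ _ 1) => [//|//|j lj x [[x0 xc] x1]|x []//].
  split => // -[_]; apply: iter_ncvg0 x0 _ (xc None) => //.
  by rewrite lt_def lambda_neq0 leNgt.
have attractedE : fine (meas (attracted g)) = \sum_(j | lambda g (mu j) < 0) w j.
  have att1 : attracted g `<=` eball 1 by move=> x [].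
  have := fine_meas_setDK (measurable_attracted g_cont) att1.
  move: w_full; rewrite -/V (bigID (fun j => lambda g (mu j) < 0))/=; lra.
have rhoE : \sum_(j < m | lambda g (mu j) < 0) spherical_measure (basin G (mu j)) =
    fine (meas (attracted g)) / V.
  by rewrite attractedE mulr_suml; apply: eq_bigr => j _; exact: basinE.
rewrite rhoE; exists (fun=> fine (meas (attracted g)) / V); split; last exact: cvg_cst.
by move=> e e0; exact: stable_density_cvg.
Qed.
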